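(* Let $I(u;\cdot):\mathbb{Z}^+\to\mathbb{R}^+$ be a collection of functions indexed by $u\in(0,\infty)$. Suppose that for each $u>0$ there exists a measurable and bounded function $I'(u;\cdot):\mathbb{R}^+\to\mathbb{R}$ such that $I(u;k)=I'(u;k)$ for all $k\in\mathbb{Z}^+$ and $$\int_0^\infty I'(u;y)\,dy-M(u)\le\sum_{k=0}^\infty I(u;k)\le\int_0^\infty I'(u;y)\,dy+M(u),$$ where $M(u)\ge\max\{I'(u;y):y>0\}$ is some upper bound for the function $I'(u;\cdot)$. If $$\lim_{u\to\infty}\frac{M(u)}{\int_0^\infty I'(u;y)\,dy}=0,$$ then $$\lim_{u\to\infty}\frac{\sum_{k=0}^\infty I(u;k)}{\int_0^\infty I'(u;y)\,dy}=1.$$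
   Context: Here $\mathbb{Z}^+=\{0,1,2,\dots\}$ and $\mathbb{R}^+=[0,\infty)$. The prime in $I'$ is only notation for an extension of $I$ to real arguments, not a derivative. The integrals $\int_0^\infty I'(u;y)\,dy$ are understood to exist as finite, nonzero numbers, so that all the displayed quotients are meaningful. *)

(* Defs.v *)
From mathcomp Require Import all_boot all_order all_algebra.
From mathcomp Require Import all_classical all_reals all_analysis.

Set Implicit Arguments.
Unset Strict Implicit.
Unset Printing Implicit Defensive.

Import Order.TTheory GRing.Theory Num.Theory.
Import numFieldNormedType.Exports.

Local Open Scope classical_set_scope.
Local Open Scope ring_scope.

(* The library equips R with the Borel sigma-algebra; lebesgueR R is R with the
   Lebesgue one, on which completed_lebesgue_measure is defined. *)
Notation lebesgueR R :=
  (caratheodory_type (mu_ext (@wlength R idfun))) (only parsing).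

Definition lebesgue_measurable_fun (R : realType) (D : set R) (f : R -> R) :=
  measurable_fun (D : set (lebesgueR R)) (f : lebesgueR R -> R).

Definition lebesgue_integrable (R : realType) (D : set R) (f : R -> R) : bool :=
  (@completed_lebesgue_measure R).-integrable D (EFin \o f).

(* Real-valued: it is the integral of f over [0, +oo[ when f is integrable
   there, and is not meaningful otherwise. *)
Definition int_pos (R : realType) (f : R -> R) : R :=
  \int[@completed_lebesgue_measure R]_(y in `[0, +oo[) f y.

(* Main.v *)
Require Import Defs.
From mathcomp Require Import all_boot all_order all_algebra.
From mathcomp Require Import all_classical all_reals all_analysis.

Set Implicit Arguments.
Unset Strict Implicit.
Unset Printing Implicit Defensive.

Import Order.TTheory GRing.Theory Num.Theory.
Import numFieldNormedType.Exports.

Local Open Scope classical_set_scope.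
Local Open Scope ring_scope.

(** Write J, S and M for the integral, the sum and the error bound at a given u.
The two-sided estimate says |S - J| <= M, so dividing by J gives
|S / J - 1| <= |M / J|, whatever the sign of J, and the right-hand side tends
to 0.  Lemma [dist_ratio_le] is this division and [cvg_ratio1] the passage to
the limit, both in R.  The sum S lives in the extended reals, but the estimate
itself forces it to be finite. *)

Lemma dist_ratio_le (R : realFieldType) (s j m : R) :
  j != 0 -> j - m <= s <= j + m -> `|1 - s / j| <= `|m / j|.
Proof.
move=> j0 sjm; rewrite -[X in X - _](divff j0) -mulrBl !normrM.
by rewrite ler_wpM2r// (le_trans _ (ler_norm m))// distrC ler_distl.
Qed.

Lemma cvg_ratio1 (R : realFieldType) (T : Type) (F : set_system T)
    (FF : Filter F) (s j m : T -> R) :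
  (\forall t \near F, j t != 0) ->
  (\forall t \near F, j t - m t <= s t <= j t + m t) ->
  m t / j t @[t --> F] --> (0 : R) -> s t / j t @[t --> F] --> (1 : R).
Proof.
move=> j0 sjm /cvgr0Pnorm_lt mj0; apply/cvgrPdist_lt => e e0.
near=> t; apply: (@le_lt_trans _ _ `|m t / j t|).
  by apply: dist_ratio_le; near: t.
by near: t; exact: mj0.
Unshelve. all: by end_near. Qed.

Theorem proposition4p1 (R : realType)
  (I : R -> nat -> R) (I' : R -> R -> R) (M : R -> R)
  (I_ge0 : forall (u : R) (k : nat), 0 < u -> 0 <= I u k)
  (I'_measurable : forall u : R, 0 < u ->
    lebesgue_measurable_fun `[0, +oo[ (I' u))
  (I'_bounded : forall u : R, 0 < u -> [bounded I' u y | y in `[0, +oo[])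
  (I'_integrable : forall u : R, 0 < u -> lebesgue_integrable `[0, +oo[ (I' u))
  (I'_int_neq0 : forall u : R, 0 < u -> int_pos (I' u) != 0)
  (II' : forall (u : R) (k : nat), 0 < u -> I u k = I' u k%:R)
  (M_ubound : forall u : R, 0 < u ->
    ubound [set I' u y | y in `]0, +oo[] (M u))
  (sum_I : forall u : R, 0 < u ->
    ((int_pos (I' u) - M u)%:E <= \sum_(0 <= k <oo) (I u k)%:E
       <= (int_pos (I' u) + M u)%:E)%E)
  (M_small : M u / int_pos (I' u) @[u --> +oo] --> 0) :
  ((\sum_(0 <= k <oo) (I u k)%:E) / (int_pos (I' u))%:E)%E @[u --> +oo]
    --> 1%E.
Proof.
pose S u : \bar R := (\sum_(0 <= k <oo) (I u k)%:E)%E.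
(* A sum caught between two reals is finite, so it can be moved to R. *)
have S_fin u : 0 < u -> (fine (S u))%:E = S u.
  move=> u0; have /andP[lbS ubS] := sum_I u u0.
  rewrite fineK// fin_numElt.
  by rewrite (lt_le_trans _ lbS) ?ltNyr// (le_lt_trans ubS) ?ltry.
have u_gt0 : \forall u \near +oo, (0 : R) < u by exact: nbhs_pinfty_gt.
apply: (@cvg_trans _ ((fine (S u) / int_pos (I' u))%:E @[u --> +oo])).
  apply: near_eq_cvg; near=> u.
  have u0 : 0 < u by near: u.
  by rewrite EFinM -/(S u) -[in RHS]S_fin// inver (negbTE (I'_int_neq0 u u0)).
apply: cvg_EFin; first by near=> u.
apply: cvg_ratio1 M_small; near=> u; have u0 : 0 < u by near: u.
- exact: I'_int_neq0.
- by rewrite -!lee_fin S_fin//; exact: sum_I.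
Unshelve. all: by end_near. Qed.
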